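(* There is a universal constant $C>0$ such that for all probability distributions $p$ and $q$ over a finite set $\mathcal X$ and all $0\le\varepsilon\le d_{\mathrm{TV}}(p,q)/4$, $$n^*_{\mathrm{TV}}(\varepsilon/2)\le C\,n^*_{\mathrm{Hub}}(\varepsilon)\qquad\text{and}\qquad n^*_{\mathrm{Hub}}(\varepsilon)\le C\,n^*_{\mathrm{TV}}(\varepsilon).$$
   Context: $\Delta(\mathcal X)$ is the set of probability distributions on $\mathcal X$; $d_{\mathrm{TV}}(p,q)=\frac12\sum_x|p(x)-q(x)|$. For $0\le\varepsilon<1$, $\mathcal P_{\mathrm{Hub}}(p,\varepsilon)=\{(1-\varepsilon)p+\varepsilon h: h\in\Delta(\mathcal X)\}$ and $\mathcal P_{\mathrm{TV}}(p,\varepsilon)=\{p'\in\Delta(\mathcal X): d_{\mathrm{TV}}(p',p)\le\varepsilon\}$. For $A\in\{\mathrm{Hub},\mathrm{TV}\}$, the sample complexity $n^*_A(\varepsilon)$ (for the given $p,q$) is the smallest $n$ for which there is a (possibly randomised) test $\phi:\mathcal X^n\to\{0,1\}$ with $$\sup_{P\in\mathcal P_A(p,\varepsilon)}\mathbb P_{X^n\sim P^{\otimes n}}(\phi(X^n)=1)+\sup_{Q\in\mathcal P_A(q,\varepsilon)}\mathbb P_{X^n\sim Q^{\otimes n}}(\phi(X^n)=0)\le\tfrac1{10}$$ ($n^*_A(\varepsilon)=\infty$ if there is none). *)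

(* Defs.v *)
From mathcomp Require Import all_boot all_order all_algebra.
From mathcomp Require Import boolp classical_sets reals constructive_ereal ereal.

Set Implicit Arguments.
Unset Strict Implicit.
Unset Printing Implicit Defensive.

Import Order.TTheory GRing.Theory Num.Theory.
Local Open Scope classical_set_scope.
Local Open Scope ring_scope.

Definition Delta (R : realType) (X : finType) : set (X -> R) :=
  [set p | (forall x, 0 <= p x) /\ \sum_(x : X) p x = 1].
Arguments Delta : clear implicits.

Definition dTV (R : realType) (X : finType) (p q : X -> R) : R :=
  2^-1 * \sum_(x : X) `|p x - q x|.

Definition P_Hub (R : realType) (X : finType) (p : X -> R) (eps : R) :
    set (X -> R) :=
  [set (fun x => (1 - eps) * p x + eps * h x) | h in Delta R X].

Definition P_TV (R : realType) (X : finType) (p : X -> R) (eps : R) :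
    set (X -> R) :=
  [set p' | Delta R X p' /\ dTV p' p <= eps].

(* The mass function of the n-fold product of P, on X^n = {ffun 'I_n -> X}. *)
Definition iid (R : realType) (X : finType) (n : nat) (P : X -> R)
    (x : {ffun 'I_n -> X}) : R :=
  \prod_(i < n) P (x i).

(* A randomised test sends each sample to a distribution on {0,1}, here bool
   with true for 1; the deterministic tests are those with values in the point
   masses. *)
Definition rand_test (R : realType) (X : finType) (n : nat) :
    set ({ffun 'I_n -> X} -> bool -> R) :=
  [set phi | forall x, Delta R bool (phi x)].
Arguments rand_test : clear implicits.

(* Probability that phi outputs b on n independent samples from P. *)
Definition prob_output (R : realType) (X : finType) (n : nat)
    (phi : {ffun 'I_n -> X} -> bool -> R) (P : X -> R) (b : bool) : R :=
  \sum_(x : {ffun 'I_n -> X}) iid P x * phi x b.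

Definition worst_case_error (R : realType) (X : finType) (n : nat)
    (phi : {ffun 'I_n -> X} -> bool -> R) (PP QQ : set (X -> R)) : \bar R :=
  (ereal_sup [set (prob_output phi P true)%:E | P in PP]
   + ereal_sup [set (prob_output phi Q false)%:E | Q in QQ])%E.

(* Valued in \bar R so as to allow +oo, the infimum of the empty set; the
   infimum of a nonempty set of natural numbers is its least element. *)
Definition sample_complexity (R : realType) (X : finType)
    (A : (X -> R) -> R -> set (X -> R)) (p q : X -> R) (eps : R) : \bar R :=
  ereal_inf [set n%:R%:E | n in [set n : nat |
    exists2 phi, rand_test R X n phi &
      (worst_case_error phi (A p eps) (A q eps) <= (10^-1)%:E)%E]].

Definition nstar_Hub (R : realType) (X : finType) (p q : X -> R) (eps : R) :
  \bar R := sample_complexity (@P_Hub R X) p q eps.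

Definition nstar_TV (R : realType) (X : finType) (p q : X -> R) (eps : R) :
  \bar R := sample_complexity (@P_TV R X) p q eps.

(* Main.v *)
(* Huber's least favourable pair for contamination eps is, up to the factor
   1 - eps, m = max(p, d q) and M = max(q, c p), with c, d <= 1 chosen so that
   both have mass s = 1/(1 - eps).  Its affinity beta bounds every Hub test from
   below: n samples suffice only if beta^n <= 9/20.  Conversely, let T be
   sqrt(q/p) clipped to [sqrt c, 1/sqrt d].  A total-variation perturbation of
   size eps/2 changes E_p T by at most eps/2 times the oscillation of T, and
   likewise for E_q (1/T); because p T + q/T equals
   2 sqrt(m M) - (M - q)/sqrt c - (m - p)/sqrt d pointwise, the two worst-case
   expectations add up to at most 2 beta, hence have product at most beta^2.
   The Markov bound for the product of the T(x_i) over 4n samples then gives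
   total error 2 beta^(4n) <= 1/10.  The second inequality holds because
   contamination balls are contained in total variation balls. *)
Require Import Defs.
From mathcomp Require Import all_boot all_order all_algebra.
From mathcomp Require Import boolp classical_sets reals constructive_ereal ereal.
From mathcomp Require Import topology normedtype ring lra.

Set Implicit Arguments.
Unset Strict Implicit.
Unset Printing Implicit Defensive.

Import Order.TTheory GRing.Theory Num.Theory.
Import numFieldNormedType.Exports.
Local Open Scope classical_set_scope.
Local Open Scope ring_scope.

(** * Worst-case errors and comparison of sample complexities *)

Lemma worst_case_error_geD (R : realType) (X : finType) (n : nat)
    (phi : {ffun 'I_n -> X} -> bool -> R) (PP QQ : set (X -> R))
    (P Q : X -> R) (r : R) :
  (worst_case_error phi PP QQ <= r%:E)%E -> PP P -> QQ Q ->
  prob_output phi P true + prob_output phi Q false <= r.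
Proof.
move=> phi_r PPP QQQ; rewrite -lee_fin EFinD (le_trans _ phi_r)// leeD//.
  by apply: ereal_sup_ubound; exists P.
by apply: ereal_sup_ubound; exists Q.
Qed.

Lemma worst_case_error_le (R : realType) (X : finType) (n : nat)
    (phi : {ffun 'I_n -> X} -> bool -> R) (PP QQ : set (X -> R)) (r s : R) :
  (forall P, PP P -> prob_output phi P true <= r) ->
  (forall Q, QQ Q -> prob_output phi Q false <= s) ->
  (worst_case_error phi PP QQ <= (r + s)%:E)%E.
Proof.
move=> PPr QQs; rewrite EFinD leeD// ge_ereal_sup// => _ [P PPP <-].
  by rewrite lee_fin PPr.
by rewrite lee_fin QQs.
Qed.

(** Dividing by [k > 0] leaves a lower bound to be checked on each sample size admissible for [A].
    If there is none, the infimum is [+oo] and nothing remains to check. *)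
Lemma sample_complexity_le (R : realType) (X : finType)
    (A B : (X -> R) -> R -> set (X -> R)) (p q : X -> R) (r s : R) (k : nat) :
  (0 < k)%N ->
  (forall n phi, rand_test R X n phi ->
    (worst_case_error phi (A p r) (A q r) <= (10^-1)%:E)%E ->
    exists2 psi, rand_test R X (k * n) psi &
      (worst_case_error psi (B p s) (B q s) <= (10^-1)%:E)%E) ->
  (sample_complexity B p q s <= k%:R%:E * sample_complexity A p q r)%E.
Proof.
move=> k_gt0 AB; have kR_gt0 : 0 < k%:R :> R by rewrite ltr0n.
rewrite -lee_pdivrMl//; apply: le_ereal_inf_tmp => _ [n [phi phiT phi_err] <-].
rewrite lee_pdivrMl// -EFinM -natrM; apply: ereal_inf_lbound.
by exists (k * n)%N => //; have [psi] := AB _ _ phiT phi_err; exists psi.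
Qed.

Lemma sample_complexity_sub (R : realType) (X : finType)
    (A B : (X -> R) -> R -> set (X -> R)) (p q : X -> R) (r s : R) :
  B p s `<=` A p r -> B q s `<=` A q r ->
  (sample_complexity B p q s <= sample_complexity A p q r)%E.
Proof.
move=> sub_p sub_q; rewrite -[leRHS]mul1e -[1%E]/(1%:R%:E).
apply: sample_complexity_le => // n phi phiT phi_err; rewrite mul1n.
exists phi => //; apply: le_trans phi_err; rewrite leeD//.
  by apply: ereal_sup_le => _ [P /sub_p PA <-]; exists P.
by apply: ereal_sup_le => _ [Q /sub_q QA <-]; exists Q.
Qed.

Lemma sample_complexity_ge0 (R : realType) (X : finType)
    (A : (X -> R) -> R -> set (X -> R)) (p q : X -> R) (r : R) :
  (0 <= sample_complexity A p q r)%E.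
Proof. by apply: le_ereal_inf_tmp => _ [n _ <-]; rewrite lee_fin. Qed.

(** * Product distributions and randomised tests *)

(** Distributivity of product over sum. It serves both for the affinity of product distributions
    ([P] and [f] square roots of mass functions) and for the expectation of a product statistic. *)
Lemma sum_iidM (R : realType) (X : finType) (n : nat) (P f : X -> R) :
  \sum_(x : {ffun 'I_n -> X}) iid P x * \prod_(i < n) f (x i)
  = (\sum_x P x * f x) ^+ n.
Proof.
under eq_bigr do rewrite -big_split.
by rewrite -(bigA_distr_bigA (fun=> fun x => P x * f x)) prodr_const card_ord.
Qed.

Lemma sum_iid (R : realType) (X : finType) (n : nat) (P : X -> R) :
  \sum_(x : {ffun 'I_n -> X}) iid P x = (\sum_x P x) ^+ n.
Proof.
by rewrite -(bigA_distr_bigA (fun=> P)) prodr_const card_ord.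
Qed.

Lemma iid_ge0 (R : realType) (X : finType) (n : nat) (P : X -> R)
    (x : {ffun 'I_n -> X}) : (forall y, 0 <= P y) -> 0 <= iid P x.
Proof. by move=> P0; apply: prodr_ge0. Qed.

Lemma prob_outputD (R : realType) (X : finType) (n : nat)
    (phi : {ffun 'I_n -> X} -> bool -> R) (P : X -> R) :
  rand_test R X n phi -> Delta R X P ->
  prob_output phi P true + prob_output phi P false = 1.
Proof.
move=> phiT [_ P1]; rewrite -big_split/= -[RHS](expr1n _ n) -P1 -sum_iid.
by apply: eq_bigr => x _; rewrite -mulrDr -big_bool (phiT x).2 mulr1.
Qed.

Lemma prob_output_ge0 (R : realType) (X : finType) (n : nat)
    (phi : {ffun 'I_n -> X} -> bool -> R) (P : X -> R) (b : bool) :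
  rand_test R X n phi -> Delta R X P -> 0 <= prob_output phi P b.
Proof.
move=> phiT [P0 _]; apply: sumr_ge0 => x _.
by rewrite mulr_ge0 ?iid_ge0//; have [] := phiT x.
Qed.

(* AM-GM, weighted so that each error probability gets the large weight. *)
Lemma affinity_exp_le (R : realType) (X : finType) (n : nat)
    (phi : {ffun 'I_n -> X} -> bool -> R) (P Q : X -> R) :
  rand_test R X n phi -> Delta R X P -> Delta R X Q ->
  prob_output phi P true + prob_output phi Q false <= 10^-1 ->
  (\sum_x Num.sqrt (P x) * Num.sqrt (Q x)) ^+ n <= 9 / 20.
Proof.
move=> phiT DP DQ err; have [P0 _] := DP; have [Q0 _] := DQ.
pose U := iid (Num.sqrt \o P) : {ffun 'I_n -> X} -> R.
pose V := iid (Num.sqrt \o Q) : {ffun 'I_n -> X} -> R.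
have sqU x : U x ^+ 2 = iid P x.
  by rewrite -prodrXl; apply: eq_bigr => i _; rewrite sqr_sqrtr.
have sqV x : V x ^+ 2 = iid Q x.
  by rewrite -prodrXl; apply: eq_bigr => i _; rewrite sqr_sqrtr.
rewrite -sum_iidM -/U.
(* The errors have weight 2 and sum at most 1/10; the success probabilities have weight 1/8 and are
   at most 1 each. *)
suff -> : 9 / 20 = 2 * 10^-1 + 8^-1 * (1 + 1) :> R; last by field.
apply: (@le_trans _ _
  (2 * (prob_output phi P true + prob_output phi Q false)
   + 8^-1 * (prob_output phi P false + prob_output phi Q true))).
  rewrite -!big_split/= !mulr_sumr -big_split/=; apply: ler_sum => x _.
  have [phi0 phi1] := phiT x; rewrite big_bool/= in phi1.
  rewrite -/(iid (Num.sqrt \o Q) x) -/(V x) -!sqU -!sqV.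
  have := phi0 true; have := phi0 false.
  have -> : phi x true = 1 - phi x false by rewrite -phi1 addrK.
  set u := U x; set v := V x; set t := phi x false => t0 t1.
  have : 0 <= (1 - t) * (4 * u - v) ^+ 2 by rewrite mulr_ge0 ?sqr_ge0.
  have : 0 <= t * (4 * v - u) ^+ 2 by rewrite mulr_ge0 ?sqr_ge0.
  lra.
have /= PE := prob_outputD phiT DP; have QE := prob_outputD phiT DQ.
have P1 := prob_output_ge0 true phiT DP.
have Q1 := prob_output_ge0 false phiT DQ.
lra.
Qed.

(* The output is 1 with probability W / (1 + W) for the normalised product W of
   the T (x i); this is at most W, and the complement is at most W^-1. *)
Lemma product_test (R : realType) (X : finType) (n : nat) (T : X -> R)
    (tau : R) : (forall x, 0 < T x) -> 0 < tau ->
  exists2 psi, rand_test R X n psi &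
    forall P, (forall x, 0 <= P x) ->
      prob_output psi P true <= (\sum_x P x * T x) ^+ n / tau /\
      prob_output psi P false <= (\sum_x P x * (T x)^-1) ^+ n * tau.
Proof.
move=> T0 tau0; pose W (x : {ffun 'I_n -> X}) := (\prod_(i < n) T (x i)) / tau.
have W0 x : 0 < W x by rewrite divr_gt0// prodr_gt0.
have W10 x : 0 < 1 + W x by rewrite addr_gt0.
exists (fun x b => if b then W x / (1 + W x) else (1 + W x)^-1).
  move=> x; split=> [[]|]; rewrite ?big_bool/=.
  - by rewrite divr_ge0// ltW.
  - by rewrite invr_ge0 ltW.
  - by field; rewrite gt_eqF.
move=> P P0; rewrite -!sum_iidM !mulr_suml; split; apply: ler_sum => x _.
  rewrite -[leRHS]mulrA ler_wpM2l ?iid_ge0// -/(W x) ler_pdivrMr//.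
  by rewrite ler_peMr// ?lerDl ltW.
rewrite -[leRHS]mulrA ler_wpM2l ?iid_ge0// prodfV -[tau]invrK -invfM -/(W x).
by rewrite lef_pV2 ?posrE// lerDr.
Qed.

(** * Expectations and tests under total variation perturbations *)

(** Since [P - p] has total mass 0, [T] may be centred at the midpoint of [[a, b]], after which it
    is at most [(b - a) / 2] in absolute value; this half is the one in [dTV]. *)
Lemma TV_expectation_le (R : realType) (X : finType) (p P T : X -> R)
    (delta a b : R) : Delta R X p -> P_TV p delta P ->
  (forall x, a <= T x <= b) -> a <= b ->
  \sum_x P x * T x <= \sum_x p x * T x + delta * (b - a).
Proof.
move=> [_ p1] [[_ P1] Pp] Tab ab.
have -> : \sum_x P x * T x = \sum_x p x * T x
    + \sum_x (P x - p x) * (T x - (a + b) / 2).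
  under [X in _ = _ + X]eq_bigr do rewrite mulrBr mulrBl.
  by rewrite !sumrB -mulr_suml sumrB P1 p1; ring.
rewrite lerD2l; apply: (@le_trans _ _ (dTV P p * (b - a))); last first.
  by rewrite ler_wpM2r// subr_ge0.
rewrite /dTV -mulrA mulrCA mulr_suml; apply: ler_sum => x _.
apply: le_trans (ler_norm _) _; rewrite normrM ler_wpM2l//.
by have /andP[] := Tab x; rewrite ler_norml => ? ?; apply/andP; split; lra.
Qed.

(** The two worst-case expectations [A] and [B] satisfy [A * B <= beta ^+ 2] by AM-GM. With an even
    number of samples the balancing threshold, the square root of [(A / B) ^+ n.*2], is a natural
    power of [A / B]. *)
Lemma TV_test (R : realType) (X : finType) (n : nat) (p q T : X -> R)
    (delta a b beta : R) : Delta R X p -> Delta R X q -> 0 <= delta ->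
  0 < a -> a <= b -> (forall x, a <= T x <= b) ->
  \sum_x p x * T x + delta * (b - a)
    + (\sum_x q x * (T x)^-1 + delta * (a^-1 - b^-1)) <= 2 * beta ->
  exists2 psi, rand_test R X (n.*2) psi &
    (worst_case_error psi (P_TV p delta) (P_TV q delta)
     <= (2 * beta ^+ n.*2)%:E)%E.
Proof.
move=> Dp Dq delta0 a0 ab Tab.
set A := (_ + _ * (b - a)); set B := (_ + _ * (a^-1 - b^-1)) => AB.
have b0 : 0 < b by exact: lt_le_trans ab.
have T0 x : 0 < T x by have /andP[aT _] := Tab x; exact: lt_le_trans aT.
have TVab x : b^-1 <= (T x)^-1 <= a^-1.
  by have /andP[aT Tb] := Tab x; rewrite !lef_pV2 ?posrE// Tb aT.
have ba : b^-1 <= a^-1 by rewrite lef_pV2.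
have A0 : 0 < A.
  rewrite ltr_wpDr ?mulr_ge0 ?subr_ge0//; apply: (lt_le_trans a0).
  rewrite -[leLHS]mul1r -Dp.2 mulr_suml ler_sum// => x _.
  by rewrite ler_wpM2l ?Dp.1//; have /andP[] := Tab x.
have B0 : 0 < B.
  rewrite ltr_wpDr ?mulr_ge0 ?subr_ge0//.
  apply: (@lt_le_trans _ _ b^-1); first by rewrite invr_gt0.
  rewrite -[leLHS]mul1r -Dq.2 mulr_suml ler_sum// => x _.
  by rewrite ler_wpM2l ?Dq.1//; have /andP[] := TVab x.
have ABbeta : A * B <= beta ^+ 2.
  have : 0 <= (A - B) ^+ 2 by exact: sqr_ge0.
  nra.
(* The threshold that equalises the two error bounds. *)
have tau0 : 0 < (A / B) ^+ n by rewrite exprn_gt0// divr_gt0.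
have ABn : (A * B) ^+ n <= beta ^+ n.*2.
  by rewrite -mul2n exprM lerXn2r ?nnegrE ?sqr_ge0// ltW// mulr_gt0.
have [psi psiT psi_err] := product_test n.*2 T0 tau0.
exists psi => //; rewrite mulr2n mulrDl mul1r.
have AE : (A ^+ n.*2) / (A / B) ^+ n = (A * B) ^+ n.
  rewrite -mul2n exprM -exprVn -exprMn; congr (_ ^+ n); field.
  by rewrite !gt_eqF.
have BE : (B ^+ n.*2) * (A / B) ^+ n = (A * B) ^+ n.
  by rewrite -mul2n exprM -exprMn; congr (_ ^+ n); field; rewrite gt_eqF.
apply: worst_case_error_le => [P PTV|Q QTV].
  have [P0 _] := PTV.1; apply: le_trans (psi_err P P0).1 _.
  apply: le_trans ABn; rewrite -AE ler_wpM2r ?invr_ge0 ?(ltW tau0)//.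
  rewrite lerXn2r ?nnegrE ?(ltW A0)//; last exact: TV_expectation_le.
  by apply: sumr_ge0 => x _; rewrite mulr_ge0// ltW.
have [Q0 _] := QTV.1; apply: le_trans (psi_err Q Q0).2 _.
apply: le_trans ABn; rewrite -BE ler_wpM2r ?(ltW tau0)//.
rewrite lerXn2r ?nnegrE ?(ltW B0)//; last exact: TV_expectation_le.
by apply: sumr_ge0 => x _; rewrite mulr_ge0// invr_ge0 ltW.
Qed.

(* The witness t is sqrt(q / p) clipped to [a, 1/e]. *)
Lemma clipped_ratio (R : rcfType) (a e p q : R) :
  0 < a <= 1 -> 0 < e <= 1 -> 0 <= p -> 0 <= q ->
  let m := Num.max p (e ^+ 2 * q) in let M := Num.max q (a ^+ 2 * p) in
  exists2 t, a <= t <= e^-1 &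
    p * t + q * t^-1
    = 2 * (Num.sqrt m * Num.sqrt M) - a^-1 * (M - q) - e^-1 * (m - p).
Proof.
move=> /andP[a0 a1] /andP[e0 e1] p0 q0 m M.
have ae1 : a <= e^-1 by rewrite (le_trans a1)// invf_ge1.
have aN0 : a != 0 by rewrite gt_eqF.
have eN0 : e != 0 by rewrite gt_eqF.
have e2q : e ^+ 2 * q <= q by rewrite ler_piMl// expr_le1// ltW.
have a2p : a ^+ 2 * p <= p by rewrite ler_piMl// expr_le1// ltW.
have [q_lt|q_ge] := ltP q (a ^+ 2 * p).
  exists a; first by rewrite lexx ae1.
  have -> : M = a ^+ 2 * p by rewrite /M; apply/max_idPr/ltW.
  have -> : m = p by apply/max_idPl; lra.
  rewrite sqrtrM ?sqr_ge0// sqrtr_sqr gtr0_norm//.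
  have -> : Num.sqrt p * (a * Num.sqrt p) = a * p.
    by rewrite -[in RHS](sqr_sqrtr p0); ring.
  by field; rewrite eN0 aN0.
have [p_lt|p_ge] := ltP p (e ^+ 2 * q).
  exists e^-1; first by rewrite lexx ae1.
  have -> : m = e ^+ 2 * q by rewrite /m; apply/max_idPr/ltW.
  have -> : M = q by apply/max_idPl; lra.
  rewrite sqrtrM ?sqr_ge0// sqrtr_sqr gtr0_norm//.
  by rewrite -mulrA -expr2 sqr_sqrtr//; field; rewrite aN0 eN0.
have -> : m = p by apply/max_idPl.
have -> : M = q by apply/max_idPl.
rewrite !subrr !mulr0 !subr0.
(* Here [sqrt(q / p)] is undefined; but [e ^+ 2 * q <= p] forces [q = 0], so any admissible [t] will
   do. *)
have [p_eq0|p_neq0] := eqVneq p 0.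
  have -> : q = 0.
    apply: le_anti; rewrite q0 -(pmulr_rle0 _ (exprn_gt0 2 e0)).
    by rewrite (le_trans p_ge)// p_eq0.
  by exists a; rewrite ?lexx ?ae1// p_eq0 sqrtr0 !mul0r mulr0 addr0.
have {}p_neq0 : 0 < p by rewrite lt_neqAle eq_sym p_neq0.
have q_neq0 : 0 < q by rewrite (lt_le_trans _ q_ge)// mulr_gt0// exprn_gt0.
set u := Num.sqrt p; set v := Num.sqrt q.
have u0 : 0 < u by rewrite sqrtr_gt0.
have v0 : 0 < v by rewrite sqrtr_gt0.
have -> : p = u ^+ 2 by rewrite sqr_sqrtr.
have -> : q = v ^+ 2 by rewrite sqr_sqrtr.
exists (v / u); last by field; rewrite !gt_eqF.
rewrite ler_pdivlMr// ler_pdivrMr// [e^-1 * _]mulrC ler_pdivlMr//.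
rewrite -[a * u <= v]ler_sqr -1?[v * e <= u]ler_sqr ?nnegrE ?mulr_ge0
  ?(ltW u0) ?(ltW v0) ?(ltW a0) ?(ltW e0)//.
by rewrite !exprMn !sqr_sqrtr// q_ge [_ * e ^+ 2]mulrC.
Qed.

(** * Contamination balls and total variation balls *)

(** Solving for the contamination [h] gives a function that is nonnegative by domination and has
    mass 1 because [p] and [p'] do. *)
Lemma P_Hub_dominating (R : realType) (X : finType) (p p' : X -> R) (eps : R) :
  0 < eps -> Delta R X p -> Delta R X p' ->
  (forall x, (1 - eps) * p x <= p' x) -> P_Hub p eps p'.
Proof.
move=> eps0 [p0 p1] [p'0 p'1] pp'.
exists (fun x => (p' x - (1 - eps) * p x) / eps); last first.
  by apply/funext => x; field; rewrite gt_eqF.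
split=> [x|]; first by rewrite divr_ge0 ?subr_ge0// ltW.
by rewrite -mulr_suml sumrB -mulr_sumr p1 p'1; field; rewrite gt_eqF.
Qed.

Lemma P_Hub_sub_TV (R : realType) (X : finType) (p : X -> R) (eps : R) :
  Delta R X p -> 0 <= eps -> eps <= 1 -> P_Hub p eps `<=` P_TV p eps.
Proof.
move=> [p0 p1] eps0 eps1 _ [h [h0 h1] <-]; split.
  split=> [x|]; first by rewrite addr_ge0// mulr_ge0// subr_ge0.
  by rewrite big_split/= -!mulr_sumr p1 h1; ring.
rewrite /dTV ler_pdivrMl//; apply: (@le_trans _ _ (\sum_x eps * (h x + p x))).
  apply: ler_sum => x _.
  have -> : (1 - eps) * p x + eps * h x - p x = eps * (h x - p x) by ring.
  rewrite normrM ger0_norm// ler_wpM2l//.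
  by rewrite (le_trans (ler_normB _ _))// !ger0_norm.
by rewrite -mulr_sumr big_split/= p1 h1; lra.
Qed.

Lemma P_TV0_sub_Hub (R : realType) (X : finType) (p : X -> R) :
  Delta R X p -> P_TV p 0 `<=` P_Hub p 0.
Proof.
move=> Dp P [_ Pp]; exists p => //; apply/funext => x.
rewrite subr0 mul1r mul0r addr0; apply/esym/eqP; rewrite -subr_eq0 -normr_eq0.
have : \sum_x `|P x - p x| == 0.
  rewrite eq_le sumr_ge0// andbT.
  by rewrite -(pmulr_rle0 _ (_ : 0 < 2^-1 :> R))// invr_gt0.
by rewrite psumr_eq0// => /allP/(_ x (mem_index_enum _)).
Qed.

(** * Huber's least favourable pair and the robust statistic *)

Lemma sum_max (R : realType) (X : finType) (p q : X -> R) :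
  Delta R X p -> Delta R X q ->
  \sum_x Num.max (q x) (p x) = 1 + dTV p q.
Proof.
move=> [_ p1] [_ q1]; under eq_bigr do rewrite maxr_absE distrC.
by rewrite -mulr_suml !big_split/= p1 q1 /dTV; field.
Qed.

(** Intermediate value theorem: the mass is continuous in [a], equal to 1 at [a = 0] and at least
    [s] at [a = 1]. The strict bound [1 < s] excludes [a = 0]. The parameter enters squared so that
    [a] itself is the clipping level for a square root of the likelihood ratio. *)
Lemma exists_threshold (R : realType) (X : finType) (p q : X -> R) (s : R) :
  Delta R X p -> Delta R X q -> 1 < s <= \sum_x Num.max (q x) (p x) ->
  exists2 a, 0 < a <= 1 & \sum_x Num.max (q x) (a ^+ 2 * p x) = s.
Proof.
move=> [p0 p1] [q0 q1] /andP[s1 s_le].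
pose f a := \sum_x Num.max (q x) (a ^+ 2 * p x).
have f0 : f 0 = 1.
  rewrite -q1; apply: eq_bigr => x _.
  by rewrite expr0n/= mul0r; exact/max_idPl.
have f1 : f 1 = \sum_x Num.max (q x) (p x).
  by apply: eq_bigr => x _; rewrite expr1n mul1r.
have cf : {within `[0, 1], continuous f}.
  apply: continuous_subspaceT => a; rewrite /f.
  apply: cvg_big => [|x _]; first exact: add_continuous.
  apply: (@continuous_max R R (fun=> q x) (fun b => b ^+ 2 * p x) a).
    exact: cvg_cst.
  by apply: cvgM; [apply: cvgM; exact: cvg_id|exact: cvg_cst].
have [|a] := IVT ler01 cf (_ : Num.min (f 0) (f 1) <= s <= Num.max (f 0) (f 1)).
  by rewrite f0 f1 ge_min le_max s_le (ltW s1) orbT.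
rewrite in_itv/= => /andP[a0 a1] fa; exists a => //.
rewrite a1 andbT lt_neqAle a0 andbT; apply: contraTN s1 => /eqP a_eq0.
by rewrite -fa -a_eq0 f0 ltxx.
Qed.

Lemma dTV_le1 (R : realType) (X : finType) (p q : X -> R) :
  Delta R X p -> Delta R X q -> dTV p q <= 1.
Proof.
move=> [p0 p1] [q0 q1].
rewrite /dTV ler_pdivrMl// mulr1; have <- : \sum_x (p x + q x) = 2.
  by rewrite big_split/= p1 q1.
apply: ler_sum => x _.
by rewrite (le_trans (ler_normB _ _))// !ger0_norm.
Qed.

Lemma dTVC (R : realType) (X : finType) (p q : X -> R) : dTV p q = dTV q p.
Proof. by congr (_ * _); apply: eq_bigr => x _; rewrite distrC. Qed.

Lemma robust_statistic (R : realType) (X : finType) (p q : X -> R) (eps : R) :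
  Delta R X p -> Delta R X q -> 0 < eps -> eps <= dTV p q / 4 ->
  exists p' q' T a b, [/\ P_Hub p eps p', P_Hub q eps q',
    0 < a, a <= b & (forall x, a <= T x <= b) /\
    \sum_x p x * T x + eps / 2 * (b - a)
      + (\sum_x q x * (T x)^-1 + eps / 2 * (a^-1 - b^-1))
    <= 2 * \sum_x Num.sqrt (p' x) * Num.sqrt (q' x)].
Proof.
move=> Dp Dq eps0 eps_le; have [p0 p1] := Dp; have [q0 q1] := Dq.
have dTV1 := dTV_le1 Dp Dq.
have eps_lt1 : 0 < 1 - eps by lra.
pose s := (1 - eps)^-1.
have s0 : 0 < s by rewrite invr_gt0.
have sE : s - 1 = eps * s by rewrite /s; field; rewrite gt_eqF.
have s_gt1 : 1 < s by rewrite -subr_gt0 sE mulr_gt0.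
(* Equivalent to [eps * (1 + dTV p q) <= dTV p q], which follows from [eps <= dTV p q / 4] and
   [dTV p q <= 1]. *)
have s_le : s <= 1 + dTV p q.
  rewrite /s invf_ple ?posrE//; last by lra.
  by rewrite -[X in X <= _]mul1r ler_pdivrMr; nra.
have [|a a01 aE] := @exists_threshold R X p q s Dp Dq.
  by rewrite s_gt1 sum_max.
have [|e e01 eE] := @exists_threshold R X q p s Dq Dp.
  by rewrite s_gt1 sum_max// dTVC.
have [a0 a1] := andP a01; have [e0 e1] := andP e01.
pose m x := Num.max (p x) (e ^+ 2 * q x).
pose M x := Num.max (q x) (a ^+ 2 * p x).
have m0 x : 0 <= m x by rewrite le_max p0.
have M0 x : 0 <= M x by rewrite le_max q0.
have Hub r r' : Delta R X r -> (forall x, r x <= r' x) -> \sum_x r' x = s ->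
    P_Hub r eps (fun x => (1 - eps) * r' x).
  move=> Dr rr' r's; apply: P_Hub_dominating => // [|x]; last first.
    by rewrite ler_wpM2l// ltW.
  split=> [x|]; last by rewrite -mulr_sumr r's divff ?gt_eqF.
  by rewrite mulr_ge0 ?(ltW eps_lt1)// (le_trans _ (rr' x))// Dr.1.
have /choice[T TP] x : exists t, a <= t <= e^-1 /\ p x * t + q x * t^-1
    = 2 * (Num.sqrt (m x) * Num.sqrt (M x)) - a^-1 * (M x - q x)
      - e^-1 * (m x - p x).
  by have [t ? ?] := clipped_ratio a01 e01 (p0 x) (q0 x); exists t.
have a_inv : a + a^-1 >= 2.
  rewrite -subr_ge0; have -> : a + a^-1 - 2 = (1 - a) ^+ 2 / a.
    by field; rewrite gt_eqF.
  by rewrite divr_ge0 ?sqr_ge0// ltW.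
have e_inv : e + e^-1 >= 2.
  rewrite -subr_ge0; have -> : e + e^-1 - 2 = (1 - e) ^+ 2 / e.
    by field; rewrite gt_eqF.
  by rewrite divr_ge0 ?sqr_ge0// ltW.
have a_inv1 : 1 <= a^-1 by rewrite invf_ge1.
have e_inv1 : 1 <= e^-1 by rewrite invf_ge1.
pose S := \sum_x Num.sqrt (m x) * Num.sqrt (M x).
(* AM-GM: the affinity of [m] and [M] is at most their common mass. *)
have S_le : S <= s.
  suff : 2 * S <= \sum_x (m x + M x) by rewrite big_split/= eE aE; lra.
  rewrite mulr_sumr; apply: ler_sum => x _.
  rewrite -{2}(sqr_sqrtr (m0 x)) -{2}(sqr_sqrtr (M0 x)).
  have := sqr_ge0 (Num.sqrt (m x) - Num.sqrt (M x)); lra.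
exists (fun x => (1 - eps) * m x), (fun x => (1 - eps) * M x), T, a, e^-1.
split=> //.
- by apply: Hub => // x; rewrite le_max lexx.
- by apply: Hub => // x; rewrite le_max lexx.
- exact: le_trans e_inv1.
split=> [x|]; first by have [] := TP x.
have -> : \sum_x Num.sqrt ((1 - eps) * m x) * Num.sqrt ((1 - eps) * M x)
    = (1 - eps) * S.
  rewrite mulr_sumr; apply: eq_bigr => x _.
  rewrite !sqrtrM ?(ltW eps_lt1)// mulrACA -expr2 sqr_sqrtr//.
  exact: ltW.
have TE : \sum_x p x * T x + \sum_x q x * (T x)^-1
    = 2 * S - a^-1 * (eps * s) - e^-1 * (eps * s).
  rewrite -big_split/=; under eq_bigr do rewrite (TP _).2.
  by rewrite !sumrB -!mulr_sumr !sumrB p1 q1 eE aE sE.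
rewrite invrK addrACA TE.
(* The slack in the goal is exactly this product, plus twice the next, plus half of the third. *)
have : 0 <= eps * (s - 1) * (a^-1 + e^-1 - 2).
  by rewrite !mulr_ge0 ?(ltW eps0)//; lra.
have : 0 <= eps * (s - S) by rewrite mulr_ge0 ?(ltW eps0)//; lra.
have : 0 <= eps * (a + a^-1 - 2 + (e + e^-1 - 2)).
  by rewrite mulr_ge0 ?(ltW eps0)//; lra.
lra.
Qed.

(** * Conversion of tests and the final comparison *)

Lemma TV_test_of_Hub_test (R : realType) (X : finType) (p q : X -> R)
    (eps : R) (n : nat) (phi : {ffun 'I_n -> X} -> bool -> R) :
  Delta R X p -> Delta R X q -> 0 < eps -> eps <= dTV p q / 4 ->
  rand_test R X n phi ->
  (worst_case_error phi (P_Hub p eps) (P_Hub q eps) <= (10^-1)%:E)%E ->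
  exists2 psi, rand_test R X (4 * n) psi &
    (worst_case_error psi (P_TV p (eps / 2)) (P_TV q (eps / 2))
     <= (10^-1)%:E)%E.
Proof.
move=> Dp Dq eps0 eps_le phiT phi_err.
have [p' [q' [T [a [b [p'Hub q'Hub a0 ab [Tab AB]]]]]]] :=
  robust_statistic Dp Dq eps0 eps_le.
have eps1 : eps <= 1 by have := dTV_le1 Dp Dq; lra.
have Dp' := (P_Hub_sub_TV Dp (ltW eps0) eps1 p'Hub).1.
have Dq' := (P_Hub_sub_TV Dq (ltW eps0) eps1 q'Hub).1.
have beta_le := affinity_exp_le phiT Dp' Dq'
  (worst_case_error_geD phi_err p'Hub q'Hub).
have eps2 : 0 <= eps / 2 by rewrite divr_ge0// ltW.
have [psi psiT psi_err] := TV_test n.*2 Dp Dq eps2 a0 ab Tab AB.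
have -> : (4 * n = n.*2.*2)%N by rewrite -!mul2n mulnA.
exists psi => //; apply: le_trans psi_err _; rewrite lee_fin.
move: beta_le; set beta := \sum_x _ => beta_le.
have beta0 : 0 <= beta by apply: sumr_ge0 => x _; rewrite mulr_ge0.
(* The fourth power is the first for which [2 * (9 / 20) ^+ k] drops below 1/10; hence the factor 4
   in the sample size. *)
have -> : beta ^+ n.*2.*2 = (beta ^+ n) ^+ 4.
  by rewrite -exprM -!mul2n mulnA mulnC.
apply: (@le_trans _ _ (2 * (9 / 20) ^+ 4)); last by lra.
by rewrite ler_wpM2l// lerXn2r ?nnegrE ?exprn_ge0.
Qed.

Theorem theorem6p1 (R : realType) :
  exists2 C : R, 0 < C &
    forall (X : finType) (p q : X -> R) (eps : R),
      Delta R X p -> Delta R X q ->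
      0 <= eps -> eps <= dTV p q / 4 ->
      (nstar_TV p q (eps / 2) <= C%:E * nstar_Hub p q eps)%E /\
      (nstar_Hub p q eps <= C%:E * nstar_TV p q eps)%E.
Proof.
exists 4 => // X p q eps Dp Dq eps0 eps_le.
have le4 (x y : \bar R) : (0 <= y -> x <= y -> x <= 4%:E * y)%E.
  move=> y0 /le_trans; apply.
  by rewrite -[leLHS]mul1e lee_wpmul2r// lee_fin; lra.
have eps1 : eps <= 1 by have := dTV_le1 Dp Dq; lra.
split; last first.
  by apply/le4/sample_complexity_sub; rewrite ?sample_complexity_ge0//;
    exact: P_Hub_sub_TV.
(* The least favourable pair is built for [eps > 0] only; at [eps = 0] the total variation ball is a
   single point, inside the contamination ball. *)
have [->|eps_neq0] := eqVneq eps 0.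
  rewrite mul0r; apply/le4/sample_complexity_sub;
    rewrite ?sample_complexity_ge0//; exact: P_TV0_sub_Hub.
apply: sample_complexity_le => // n phi; apply: TV_test_of_Hub_test => //.
by rewrite lt_neqAle eq_sym eps_neq0.
Qed.
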